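(* Assume (QP) has an optimal solution, let $\gamma\in(0,1)$, and let $\tau_p,\tau_d>0$ be problem-dependent error bound constants for (QP) (as defined in the context). Put $C_2=\sqrt{n/\gamma}+n$. Let $C>0$ and fix a vector $\lambda\in\mathbb{R}^n$, $\lambda\ge0$, such that $$0<\|\lambda\|<\min\left(1,\ \frac{C}{8\max(\tau_p,\tau_d)}\right).$$ Let $(x,y,s)\in\mathcal{N}_\lambda(\gamma)$ with $$\mu_\lambda<\min\left(1,\ \left(\frac{C}{2\max(\tau_p,\tau_d)\,C_2}\right)^2\right).$$ Then there exists an optimal solution $(x^*,y^*,s^* )$ of (QP) such that $$\bar{\mathcal{I}}_C(x)\subseteq\mathcal{I}(x^* ),\qquad \bar{\mathcal{S}}_C(s)\subseteq\mathcal{S}(s^* ),\qquad \mathcal{T}(x^*,s^* )\subseteq\bar{\mathcal{T}}_C(x,s).$$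
   Context: Let $H\in\mathbb{R}^{n\times n}$ be symmetric positive semidefinite, $A\in\mathbb{R}^{m\times n}$ with $m\le n$, $b\in\mathbb{R}^m$, $c\in\mathbb{R}^n$. Vector inequalities are componentwise and $\|\cdot\|$ is the Euclidean norm. The pair (QP) consists of the primal problem $\min_x \frac12x^THx+c^Tx$ subject to $Ax=b$, $x\ge0$, and the dual problem $\max_{(x,y,s)} b^Ty-\frac12x^THx$ subject to $A^Ty+s-Hx=c$, $s\ge0$, $y$ free. A triple $(x^*,y^*,s^* )$ is an optimal solution of (QP) if and only if $Ax^*=b$, $A^Ty^*+s^*-Hx^*=c$, $x^*\ge0$, $s^*\ge0$ and $x_i^*s_i^*=0$ for all $i$. For $\lambda\ge0$, $\mathcal{F}^0_\lambda=\{(x,y,s): Ax=b,\ A^Ty+s-Hx=c,\ x+\lambda>0,\ s+\lambda>0\}$. For a triple $(x,y,s)$, $\mu_\lambda=\frac{(x+\lambda)^T(s+\lambda)}{n}$. For $\gamma\in(0,1)$, $\mathcal{N}_\lambda(\gamma)=\{(x,y,s)\in\mathcal{F}^0_\lambda: \gamma\mu_\lambda\le(x_i+\lambda_i)(s_i+\lambda_i)\le\mu_\lambda/\gamma,\ i=1,\dots,n\}$. Problem-dependent error bound constants: $\tau_p,\tau_d>0$ are constants depending only on $(H,A,b,c)$ such that for every $\gamma\in(0,1)$, every $\lambda\ge0$ and every $(x,y,s)\in\mathcal{N}_\lambda(\gamma)$ there is an optimal solution $(x^*,y^*,s^* )$ of (QP) with $\|x-x^*\|<\tau_p\,\beta$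 and $\|s-s^*\|<\tau_d\,\beta$, where $\beta=(\sqrt{n/\gamma}+n)\sqrt{\mu_\lambda}\max(\sqrt{\mu_\lambda},1)+4\|\lambda\|\max(\|\lambda\|,1)$. (Such constants exist when (QP) has an optimal solution.) Sets (with $i$ ranging over $\{1,\dots,n\}$): $\mathcal{I}(x^* )=\{i:x_i^*>0\}$, $\mathcal{S}(s^* )=\{i:s_i^*>0\}$, $\mathcal{T}(x^*,s^* )=\{1,\dots,n\}\setminus(\mathcal{S}(s^* )\cup\mathcal{I}(x^* ))$; $\bar{\mathcal{I}}_C(x)=\{i:x_i\ge C\}$, $\bar{\mathcal{S}}_C(s)=\{i:s_i\ge C\}$, $\bar{\mathcal{T}}_C(x,s)=\{1,\dots,n\}\setminus(\bar{\mathcal{S}}_C(s)\cup\bar{\mathcal{I}}_C(x))$. *)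

(* Defs.v *)
From HB Require Import structures.
From mathcomp Require Import all_boot all_order all_algebra.
From mathcomp Require Import boolp reals.
From mathcomp Require Import ring lra.

Set Implicit Arguments.
Unset Strict Implicit.
Unset Printing Implicit Defensive.

Import Order.TTheory GRing.Theory Num.Theory.
Local Open Scope ring_scope.

Definition dot (R : realType) (n : nat) (u v : 'cV[R]_n) : R := (u^T *m v) 0 0.

(* The norm `|v| that the library puts on matrices is the sup norm, hence a
   separate Euclidean norm. *)
Definition norm2 (R : realType) (n : nat) (v : 'cV[R]_n) : R :=
  Num.sqrt (dot v v).

Definition cv_nonneg (R : realType) (n : nat) (v : 'cV[R]_n) : Prop :=
  forall i, 0 <= v i 0.

Definition cv_pos (R : realType) (n : nat) (v : 'cV[R]_n) : Prop :=
  forall i, 0 < v i 0.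

Definition symmetric_mx (R : realType) (n : nat) (H : 'M[R]_n) : Prop := H^T = H.

Definition psd_mx (R : realType) (n : nat) (H : 'M[R]_n) : Prop :=
  forall v : 'cV[R]_n, 0 <= dot v (H *m v).

Definition primal_feasible (R : realType) (m n : nat) (A : 'M[R]_(m, n))
    (b : 'cV[R]_m) (x : 'cV[R]_n) : Prop :=
  A *m x = b /\ cv_nonneg x.

Definition primal_obj (R : realType) (n : nat) (H : 'M[R]_n) (c x : 'cV[R]_n) : R :=
  2^-1 * dot x (H *m x) + dot c x.

Definition dual_feasible (R : realType) (m n : nat) (H : 'M[R]_n)
    (A : 'M[R]_(m, n)) (c x : 'cV[R]_n) (y : 'cV[R]_m) (s : 'cV[R]_n) : Prop :=
  A^T *m y + s - H *m x = c /\ cv_nonneg s.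

Definition dual_obj (R : realType) (m n : nat) (H : 'M[R]_n) (b : 'cV[R]_m)
    (x : 'cV[R]_n) (y : 'cV[R]_m) : R :=
  dot b y - 2^-1 * dot x (H *m x).

Definition primal_optimal (R : realType) (m n : nat) (H : 'M[R]_n)
    (A : 'M[R]_(m, n)) (b : 'cV[R]_m) (c x : 'cV[R]_n) : Prop :=
  primal_feasible A b x /\
  forall x', primal_feasible A b x' -> primal_obj H c x <= primal_obj H c x'.

Definition dual_optimal (R : realType) (m n : nat) (H : 'M[R]_n)
    (A : 'M[R]_(m, n)) (b : 'cV[R]_m) (c x : 'cV[R]_n) (y : 'cV[R]_m)
    (s : 'cV[R]_n) : Prop :=
  dual_feasible H A c x y s /\
  forall x' y' s', dual_feasible H A c x' y' s' ->
    dual_obj H b x' y' <= dual_obj H b x y.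

(* The first component solves the primal problem and the triple solves the dual
   problem; [qp_optimalP] below shows that, for H symmetric positive
   semidefinite, this is the same as the complementarity system. *)
Definition qp_optimal (R : realType) (m n : nat) (H : 'M[R]_n)
    (A : 'M[R]_(m, n)) (b : 'cV[R]_m) (c x : 'cV[R]_n) (y : 'cV[R]_m)
    (s : 'cV[R]_n) : Prop :=
  primal_optimal H A b c x /\ dual_optimal H A b c x y s.

Definition strictly_feasible (R : realType) (m n : nat) (H : 'M[R]_n)
    (A : 'M[R]_(m, n)) (b : 'cV[R]_m) (c lam x : 'cV[R]_n) (y : 'cV[R]_m)
    (s : 'cV[R]_n) : Prop :=
  [/\ A *m x = b, A^T *m y + s - H *m x = c, cv_pos (x + lam) & cv_pos (s + lam)].

Definition mu_lambda (R : realType) (n : nat) (lam x s : 'cV[R]_n) : R :=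
  dot (x + lam) (s + lam) / n%:R.

Definition neighbourhood (R : realType) (m n : nat) (H : 'M[R]_n)
    (A : 'M[R]_(m, n)) (b : 'cV[R]_m) (c : 'cV[R]_n) (gamma : R)
    (lam x : 'cV[R]_n) (y : 'cV[R]_m) (s : 'cV[R]_n) : Prop :=
  strictly_feasible H A b c lam x y s /\
  forall i, gamma * mu_lambda lam x s <= (x i 0 + lam i 0) * (s i 0 + lam i 0)
            /\ (x i 0 + lam i 0) * (s i 0 + lam i 0) <= mu_lambda lam x s / gamma.

Definition C2 (R : realType) (n : nat) (gamma : R) : R :=
  Num.sqrt (n%:R / gamma) + n%:R.

Definition beta (R : realType) (n : nat) (gamma : R) (lam x s : 'cV[R]_n) : R :=
  C2 n gamma * Num.sqrt (mu_lambda lam x s) * Num.max (Num.sqrt (mu_lambda lam x s)) 1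
  + 4 * norm2 lam * Num.max (norm2 lam) 1.

(* tau_p and tau_d serve all gamma, lam and (x, y, s) at once: they may depend on
   the data (H, A, b, c) only. *)
Definition error_bound_constants (R : realType) (m n : nat) (H : 'M[R]_n)
    (A : 'M[R]_(m, n)) (b : 'cV[R]_m) (c : 'cV[R]_n) (tau_p tau_d : R) : Prop :=
  [/\ 0 < tau_p, 0 < tau_d &
    forall (gamma : R) (lam x : 'cV[R]_n) (y : 'cV[R]_m) (s : 'cV[R]_n),
      0 < gamma < 1 -> cv_nonneg lam -> neighbourhood H A b c gamma lam x y s ->
      exists x' y' s', [/\ qp_optimal H A b c x' y' s',
        norm2 (x - x') < tau_p * beta gamma lam x s &
        norm2 (s - s') < tau_d * beta gamma lam x s]].

(* I(x) = pos_set x and S(s) = pos_set s; the predicted sets are ge_set C x and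
   ge_set C s. *)
Definition pos_set (R : realType) (n : nat) (v : 'cV[R]_n) : {set 'I_n} :=
  [set i | 0 < v i 0].

Definition ge_set (R : realType) (n : nat) (C : R) (v : 'cV[R]_n) : {set 'I_n} :=
  [set i | C <= v i 0].

Definition tripartition_rest (R : realType) (n : nat) (x s : 'cV[R]_n) : {set 'I_n} :=
  ~: (pos_set s :|: pos_set x).

Definition tripartition_rest_ge (R : realType) (n : nat) (C : R) (x s : 'cV[R]_n) :
    {set 'I_n} :=
  ~: (ge_set C s :|: ge_set C x).

Lemma dotE (R : realType) n (u v : 'cV[R]_n) : dot u v = \sum_i u i 0 * v i 0.
Proof. by rewrite /dot mxE; apply: eq_bigr => i _; rewrite mxE. Qed.

Lemma dotC (R : realType) n (u v : 'cV[R]_n) : dot u v = dot v u.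
Proof. by rewrite !dotE; apply: eq_bigr => i _; rewrite mulrC. Qed.

Lemma dotDl (R : realType) n (u v w : 'cV[R]_n) : dot (u + v) w = dot u w + dot v w.
Proof. by rewrite /dot linearD /= mulmxDl mxE. Qed.

Lemma dotZl (R : realType) n (a : R) (u v : 'cV[R]_n) : dot (a *: u) v = a * dot u v.
Proof. by rewrite /dot linearZ /= -scalemxAl mxE. Qed.

Lemma dotNl (R : realType) n (u v : 'cV[R]_n) : dot (- u) v = - dot u v.
Proof. by rewrite -scaleN1r dotZl mulN1r. Qed.

Lemma dotDr (R : realType) n (u v w : 'cV[R]_n) : dot u (v + w) = dot u v + dot u w.
Proof. by rewrite dotC dotDl !(dotC _ u). Qed.

Lemma dotZr (R : realType) n (a : R) (u v : 'cV[R]_n) : dot u (a *: v) = a * dot u v.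
Proof. by rewrite dotC dotZl dotC. Qed.

Lemma dotNr (R : realType) n (u v : 'cV[R]_n) : dot u (- v) = - dot u v.
Proof. by rewrite dotC dotNl dotC. Qed.

Lemma dot_mulmx (R : realType) m n (A : 'M[R]_(m, n)) u v :
  dot u (A *m v) = dot (A^T *m u) v.
Proof. by rewrite /dot trmx_mul trmxK mulmxA. Qed.

Lemma dot_delta (R : realType) n (i : 'I_n) (v : 'cV[R]_n) :
  dot (delta_mx i 0) v = v i 0.
Proof. by rewrite /dot trmx_delta -rowE mxE. Qed.

Lemma dot_ge0 (R : realType) n (u v : 'cV[R]_n) :
  cv_nonneg u -> cv_nonneg v -> 0 <= dot u v.
Proof. by move=> u0 v0; rewrite dotE sumr_ge0 // => i _; rewrite mulr_ge0. Qed.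

Definition complementarity (R : realType) (m n : nat) (H : 'M[R]_n)
    (A : 'M[R]_(m, n)) (b : 'cV[R]_m) (c x : 'cV[R]_n) (y : 'cV[R]_m)
    (s : 'cV[R]_n) : Prop :=
  [/\ A *m x = b, A^T *m y + s - H *m x = c, cv_nonneg x, cv_nonneg s &
      forall i, x i 0 * s i 0 = 0].

(* Farkas' lemma, by Bartl's induction on the number of constraints. The cone that
   the list generates is given through its closure properties. *)
Lemma farkas (R : realType) n (l : seq 'cV[R]_n) (g : 'cV[R]_n)
    (K : 'cV[R]_n -> Prop) :
  K 0 -> (forall u v, K u -> K v -> K (u + v)) ->
  (forall t u, 0 <= t -> K u -> K (t *: u)) ->
  (forall a, a \in l -> K a) ->
  (forall d, (forall a, a \in l -> 0 <= dot a d) -> 0 <= dot g d) ->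
  K g.
Proof.
move=> K0 KD KZ; move: {2}(size l) (erefl (size l)) => k.
elim: k l g => [|k IH] [|B l] //= g.
  move=> _ _ gl; suff -> : g = 0 by [].
  apply/matrixP => i j; rewrite ord1 mxE {j}.
  have := gl (- g i 0 *: delta_mx i 0) (fun a => ltac:(by rewrite in_nil)).
  rewrite dotZr dotC dot_delta mulNr oppr_ge0 -expr2 => gi.
  by apply/eqP; rewrite -sqrf_eq0 eq_le gi sqr_ge0.
move=> [sl] Kl gl.
have KB : K B by apply: Kl; rewrite inE eqxx.
have [gl'|] := pselect (forall d, (forall a, a \in l -> 0 <= dot a d) -> 0 <= dot g d).
  by apply: (IH l) => // a al; apply: Kl; rewrite inE al orbT.
move=> /existsNP[d0 /not_implyP[ld0 /negP]]; rewrite -ltNge => gd0.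
have Bd0 : dot B d0 < 0.
  rewrite ltNge; apply/negP => Bd0; move: gd0; rewrite ltNge gl // => a.
  by rewrite inE => /predU1P[->//|]; exact: ld0.
have nB0 : 0 < (- dot B d0)^-1 by rewrite invr_gt0 oppr_gt0.
set e := (- dot B d0)^-1 *: d0.
have Be : dot B e = -1.
  by rewrite dotZr invrN mulNr mulVf // lt_eqF.
have le a : a \in l -> 0 <= dot a e.
  by move=> al; rewrite dotZr mulr_ge0 ?ld0 // ltW.
have ge : dot g e < 0 by rewrite dotZr pmulr_rlt0.
clearbody e.
have -> : g = (g + dot g e *: B) + (- dot g e) *: B.
  by rewrite scaleNr addrK.
apply: (KD _ _); last by apply: (KZ _ _) => //; rewrite oppr_ge0 ltW.
apply: (IH [seq a + dot a e *: B | a <- l]); first by rewrite size_map.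
  move=> _ /mapP[a al ->]; apply: (KD _ _); first by apply: Kl; rewrite inE al orbT.
  by apply: (KZ _ _) => //; exact: le.
move=> d ld.
have -> : dot (g + dot g e *: B) d = dot g (d + dot B d *: e).
  by rewrite dotDl dotDr dotZl dotZr [dot g e * _]mulrC.
apply: gl => a; rewrite inE => /predU1P[->|al].
  by rewrite dotDr dotZr Be mulrN1 subrr.
have := ld _ (map_f (fun a => a + dot a e *: B) al).
by rewrite dotDl dotDr dotZl dotZr [dot a e * _]mulrC.
Qed.

Lemma duality_gap (R : realType) m n (H : 'M[R]_n) (A : 'M[R]_(m, n)) b c x x' y s :
  symmetric_mx H -> A *m x = b -> A^T *m y + s - H *m x' = c ->
  primal_obj H c x - dual_obj H b x' y
  = 2^-1 * dot (x - x') (H *m (x - x')) + dot s x.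
Proof.
move=> Hs <- <-; rewrite /primal_obj /dual_obj mulmxBr.
rewrite !(dotDl, dotDr, dotNl, dotNr) -dot_mulmx [dot (A *m x) y]dotC.
have -> : dot (H *m x') x = dot x (H *m x') by rewrite dotC.
have -> : dot x' (H *m x) = dot x (H *m x') by rewrite dot_mulmx Hs dotC.
by field.
Qed.

Lemma complementarity_optimal (R : realType) m n (H : 'M[R]_n) (A : 'M[R]_(m, n))
    b c x y s :
  symmetric_mx H -> psd_mx H -> complementarity H A b c x y s -> qp_optimal H A b c x y s.
Proof.
move=> Hs Hp [Ax dE x0 s0 xs].
have D : primal_obj H c x = dual_obj H b x y.
  apply/eqP; rewrite -subr_eq0 (duality_gap Hs Ax dE) subrr mulmx0.
  rewrite !dotE !big1 ?mulr0 ?addr0 // => i _; first by rewrite mulrC xs.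
  by rewrite mxE mul0r.
have weak x1 x2 y2 s2 : primal_feasible A b x1 -> dual_feasible H A c x2 y2 s2 ->
    dual_obj H b x2 y2 <= primal_obj H c x1.
  move=> [Ax1 x10] [dE2 s20]; rewrite -subr_ge0 (duality_gap Hs Ax1 dE2).
  by rewrite addr_ge0 ?dot_ge0 // mulr_ge0 ?Hp // invr_ge0.
split; split=> //.
  by move=> x' fx'; rewrite D; apply: weak fx' _; split; eassumption.
by move=> x' y' s' f; rewrite -D; apply: weak f.
Qed.

Lemma primal_optimal_direction (R : realType) m n (H : 'M[R]_n) (A : 'M[R]_(m, n))
    b c x d :
  symmetric_mx H -> psd_mx H -> primal_optimal H A b c x ->
  A *m d = 0 -> (forall i, x i 0 = 0 -> 0 <= d i 0) -> 0 <= dot (H *m x + c) d.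
Proof.
move=> Hs Hp [[Ax x0] xmin] Ad d0; rewrite leNgt; apply/negP => gd.
pose G := - dot (H *m x + c) d; have G0 : 0 < G by rewrite oppr_gt0.
pose Q := dot d (H *m d); have Q0 : 0 <= Q by exact: Hp.
pose F i := `|d i 0| / x i 0.
have F0 i : 0 <= F i by rewrite mulr_ge0 // invr_ge0.
pose M := 1 + \sum_i F i.
have M0 : 0 < M by rewrite ltr_pwDl // sumr_ge0.
have P0 : 0 < (Q + 1) / G by rewrite divr_gt0 // ltr_wpDl.
pose w := M + (Q + 1) / G; have w0 : 0 < w by rewrite addr_gt0.
pose t := w^-1; have t0 : 0 < t by rewrite invr_gt0.
have tw : t * w = 1 by rewrite mulVf ?gt_eqF.
have tM : t * M <= 1 by rewrite -tw ler_pM2l // lerDl ltW.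
have tQ : t * (Q + 1) <= G.
  rewrite -[leRHS]mul1r -ler_pdivrMr // -mulrA -[leRHS]tw ler_pM2l //.
  by rewrite /w lerDr ltW.
have fx : primal_feasible A b (x + t *: d).
  split; first by rewrite mulmxDr -scalemxAr Ad scaler0 addr0.
  move=> i; rewrite !mxE.
  have [xi|xi] := eqVneq (x i 0) 0; first by rewrite xi add0r mulr_ge0 ?d0 // ltW.
  have xi0 : 0 < x i 0 by rewrite lt_def xi x0.
  have FM : F i <= M.
    by rewrite /M (bigD1 i) //= addrCA lerDl addr_ge0 // sumr_ge0.
  rewrite -lerBlDl sub0r; apply: (@le_trans _ _ (- (t * `|d i 0|))); last first.
    by rewrite -mulrN ler_pM2l // lerNl -normrN ler_norm.
  rewrite lerN2; apply: (@le_trans _ _ (t * (M * x i 0))).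
    by rewrite ler_pM2l // -ler_pdivrMr.
  by rewrite mulrA -[leRHS]mul1r ler_pM2r.
have := xmin _ fx; apply/negP; rewrite -ltNge -subr_lt0.
have -> : primal_obj H c (x + t *: d) - primal_obj H c x = t * (2^-1 * (t * Q) - G).
  rewrite /G /Q /primal_obj mulmxDr -scalemxAr.
  rewrite !(dotDl, dotDr, dotZl, dotZr).
  have -> : dot (H *m x) d = dot x (H *m d) by rewrite dot_mulmx Hs.
  have -> : dot d (H *m x) = dot x (H *m d) by rewrite dot_mulmx Hs dotC.
  by field.
rewrite pmulr_rlt0 //.
have : 0 <= t * Q by rewrite mulr_ge0 // ltW.
move: tQ; rewrite mulrDr mulr1; lra.
Qed.

Lemma primal_optimal_multipliers (R : realType) m n (H : 'M[R]_n) (A : 'M[R]_(m, n))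
    b c x :
  symmetric_mx H -> psd_mx H -> primal_optimal H A b c x ->
  exists y s, complementarity H A b c x y s.
Proof.
move=> Hs Hp xopt; have [[Ax x0] _] := xopt.
pose K v := exists y s, [/\ cv_nonneg s, forall i, x i 0 * s i 0 = 0 & v = A^T *m y + s].
suff [y [s [s0 xs E]]] : K (H *m x + c).
  by exists y, s; split => //; rewrite -E addrAC subrr add0r.
apply: (@farkas _ _ ([seq A^T *m delta_mx j 0 | j : 'I_m] ++
    [seq A^T *m - delta_mx j 0 | j : 'I_m] ++
    [seq delta_mx i 0 | i <- enum 'I_n & x i 0 == 0])).
- by exists 0, 0; split=> [i|i|]; rewrite ?mulmx0 ?addr0 // mxE ?mulr0.
- move=> _ _ [y1 [s1 [p1 q1 ->]]] [y2 [s2 [p2 q2 ->]]]; exists (y1 + y2), (s1 + s2).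
  split=> [i|i|]; first by rewrite mxE addr_ge0.
    by rewrite mxE mulrDr q1 q2 addr0.
  by rewrite mulmxDr addrACA.
- move=> t _ t0 [y1 [s1 [p1 q1 ->]]]; exists (t *: y1), (t *: s1).
  split=> [i|i|]; first by rewrite mxE mulr_ge0.
    by rewrite mxE mulrCA q1 mulr0.
  by rewrite -scalemxAr scalerDr.
- have KA y : K (A^T *m y).
    by exists y, 0; split=> [i|i|]; rewrite ?addr0 // mxE ?mulr0.
  move=> a; rewrite !mem_cat => /or3P[/mapP[j _ ->]|/mapP[j _ ->]|/mapP[i ix ->]] //.
  move: ix; rewrite mem_filter => /andP[/eqP xi _].
  exists 0, (delta_mx i 0); split=> [k|k|]; last by rewrite mulmx0 add0r.
    by rewrite mxE andbT ler0n.
  by rewrite mxE andbT; case: eqP => [->|_]; rewrite ?xi ?mul0r ?mulr0.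
move=> d ld; apply: (primal_optimal_direction Hs Hp xopt).
  apply/matrixP => j k; rewrite ord1 [RHS]mxE {k}; apply/eqP; rewrite eq_le.
  apply/andP; split; last first.
    rewrite -dot_delta dot_mulmx; apply: ld.
    by rewrite mem_cat; apply/orP; left; apply/mapP; exists j; rewrite ?mem_enum.
  rewrite -oppr_ge0 -dot_delta -dotNl dot_mulmx; apply: ld.
  rewrite !mem_cat; apply/or3P; apply: Or32.
  by apply/mapP; exists j; rewrite ?mem_enum.
move=> i xi; rewrite -dot_delta; apply: ld.
rewrite !mem_cat; apply/or3P; apply: Or33.
by apply/mapP; exists i => //; rewrite mem_filter mem_enum xi eqxx.
Qed.

Theorem qp_optimalP (R : realType) (m n : nat) (H : 'M[R]_n) (A : 'M[R]_(m, n))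
    (b : 'cV[R]_m) (c x : 'cV[R]_n) (y : 'cV[R]_m) (s : 'cV[R]_n) :
  symmetric_mx H -> psd_mx H ->
  qp_optimal H A b c x y s <-> complementarity H A b c x y s.
Proof.
move=> Hs Hp; split; last exact: complementarity_optimal.
move=> [xopt [[dE s0] dopt]]; have [[Ax x0] _] := xopt.
split=> //.
have [y1 [s1 [_ dE1 _ s10 xs1]]] := primal_optimal_multipliers Hs Hp xopt.
have Z (v : 'cV[R]_n) : dot (x - x) v = 0.
  by rewrite subrr dotE big1 // => i _; rewrite mxE mul0r.
have := dopt x y1 s1 (conj dE1 s10).
have g1 := duality_gap Hs Ax dE1; have g := duality_gap Hs Ax dE.
have s1x : dot s1 x = 0 by rewrite dotE big1 // => i _; rewrite mulrC xs1.
rewrite Z s1x in g1; rewrite Z in g => le1.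
have /eqP : dot s x = 0.
  by apply/eqP; rewrite eq_le dot_ge0 // andbT; lra.
rewrite dotE psumr_eq0 => [/allP h i|i _]; last by rewrite mulr_ge0.
by have /eqP := h i (mem_index_enum _); rewrite mulrC.
Qed.

(* Main.v *)
(** Under the smallness hypotheses both maxima in [beta] equal 1, and each of
    its two terms is at most half of [C / max(tau_p, tau_d)].  So some solution
    is within distance less than [C] of [(x, s)], and the entries that are at
    least [C] stay positive there. *)
Require Import Defs.
From HB Require Import structures.
From mathcomp Require Import all_boot all_order all_algebra.
From mathcomp Require Import reals.
From mathcomp Require Import ring lra.

Set Implicit Arguments.
Unset Strict Implicit.
Unset Printing Implicit Defensive.

Import Order.TTheory GRing.Theory Num.Theory.
Local Open Scope ring_scope.

(** A single square is at most the sum of all squares. *)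
Lemma le_norm2 (R : realType) (n : nat) (v : 'cV[R]_n) (i : 'I_n) :
  `|v i 0| <= norm2 v.
Proof.
rewrite -sqrtr_sqr ler_wsqrtr // dotE (bigD1 i) //= -expr2 lerDl.
by apply: sumr_ge0 => j _; rewrite -expr2 sqr_ge0.
Qed.

Lemma ge_set_sub_pos_set (R : realType) (n : nat) (C : R) (u v : 'cV[R]_n) :
  norm2 (u - v) < C -> ge_set C u \subset pos_set v.
Proof.
move=> uvC; apply/subsetP => i; rewrite !inE => Cu.
have := le_lt_trans (le_norm2 _ i) uvC; rewrite !mxE ltr_norml => /andP[_]; lra.
Qed.

Lemma C2_ge0 (R : realType) (n : nat) (gamma : R) : 0 <= C2 n gamma.
Proof. by rewrite addr_ge0 ?sqrtr_ge0. Qed.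

(** [T] stands for the larger of the two error bound constants. *)
Lemma beta_lt (R : realType) (n : nat) (gamma T C : R) (lam x s : 'cV[R]_n) :
  0 < T -> 0 < C ->
  norm2 lam < Num.min 1 (C / (8 * T)) ->
  mu_lambda lam x s < Num.min 1 ((C / (2 * T * C2 n gamma)) ^+ 2) ->
  beta gamma lam x s < C / T.
Proof.
move=> T0 C0; rewrite !lt_min => /andP[lam1 lamC] /andP[/ltW mu1 /ltW muC].
have k0 := C2_ge0 n gamma.
(* [Num.sqrt] is 0 on negative reals, hence monotone everywhere: bounds on [mu_lambda] pass to its
   root whatever its sign. *)
have smu1 : Num.sqrt (mu_lambda lam x s) <= 1 by rewrite -[leRHS]sqrtr1 ler_wsqrtr.
have smuC : Num.sqrt (mu_lambda lam x s) <= C / (2 * T * C2 n gamma).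
  apply: le_trans (ler_wsqrtr muC) _; rewrite sqrtr_sqr ger0_norm //.
  by rewrite divr_ge0 ?mulr_ge0 // ltW.
rewrite /beta (max_idPr smu1) (max_idPr (ltW lam1)) !mulr1.
have -> : C / T = C / (2 * T) + 4 * (C / (8 * T)) by field; rewrite gt_eqF.
(* The [lam] term supplies the strictness; a weak bound suffices for the [mu_lambda] term. *)
apply: ler_ltD; last by rewrite ltr_pM2l.
(* The factor [C2 n gamma] can be cancelled only if it is nonzero; if it is 0, so is the whole
   term. *)
have [->|kN0] := eqVneq (C2 n gamma) 0.
  by rewrite mul0r divr_ge0 ?mulr_ge0 // ltW.
apply: le_trans (ler_wpM2l k0 smuC) _.
by rewrite [X in X <= _](_ : _ = C / (2 * T)) //; field; rewrite kN0 gt_eqF.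
Qed.

Theorem theorem10 (R : realType) (m n : nat) (H : 'M[R]_n) (A : 'M[R]_(m, n))
    (b : 'cV[R]_m) (c : 'cV[R]_n) (gamma tau_p tau_d C : R) (lam : 'cV[R]_n)
    (x : 'cV[R]_n) (y : 'cV[R]_m) (s : 'cV[R]_n) :
  symmetric_mx H -> psd_mx H -> (m <= n)%N ->
  (exists x0 y0 s0, qp_optimal H A b c x0 y0 s0) ->
  0 < gamma < 1 ->
  error_bound_constants H A b c tau_p tau_d ->
  0 < C ->
  cv_nonneg lam ->
  0 < norm2 lam < Num.min 1 (C / (8 * Num.max tau_p tau_d)) ->
  neighbourhood H A b c gamma lam x y s ->
  mu_lambda lam x s < Num.min 1 ((C / (2 * Num.max tau_p tau_d * C2 n gamma)) ^+ 2) ->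
  exists xo yo so, [/\ qp_optimal H A b c xo yo so,
    ge_set C x \subset pos_set xo,
    ge_set C s \subset pos_set so &
    tripartition_rest xo so \subset tripartition_rest_ge C x s].
Proof.
move=> _ _ _ _ g01 [tp0 td0 eb] C0 lam0 /andP[_ lamC] nbh muC.
have T0 : 0 < Num.max tau_p tau_d by rewrite lt_max tp0.
have bC := beta_lt T0 C0 lamC muC.
(* Stated for any [t] up to the maximum, so as to serve [tau_p] and [tau_d] alike. *)
have tauC t : 0 < t -> t <= Num.max tau_p tau_d -> t * beta gamma lam x s < C.
  move=> t0 tT; apply: lt_le_trans (_ : t * (C / Num.max tau_p tau_d) <= _).
    by rewrite ltr_pM2l.
  by rewrite mulrCA ler_piMr ?(ltW C0) ?ler_pdivrMr ?mul1r.
have [xo [yo [so [opt dx ds]]]] := eb _ _ _ _ _ g01 lam0 nbh.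
have Ix : ge_set C x \subset pos_set xo.
  by apply/ge_set_sub_pos_set/(lt_trans dx)/tauC; rewrite ?le_max ?lexx.
have Ss : ge_set C s \subset pos_set so.
  by apply/ge_set_sub_pos_set/(lt_trans ds)/tauC; rewrite ?le_max ?lexx ?orbT.
(* Complementation reverses the union of the first two inclusions, which gives the third. *)
by exists xo, yo, so; split=> //; rewrite setCS setUSS.
Qed.
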